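(* If $G$ is a connected cograph of order $n\geq 7$, then $$M_{G}\leq \frac{n+1}{2}-\frac{(n-1)^{2}}{2(2^{n-1}+n-1)},$$ with equality if and only if $G\cong K_{1,n-1}$. Generally, if $G$ is a connected cograph of order $n\geq 1$, then $M_G\leq \tfrac{n+1}{2}$, with equality if and only if $n=1$.
   Context: All graphs are finite and simple with at least one vertex; the order of a graph is its number of vertices. A graph is a cograph if it contains no induced path on $4$ vertices. For a graph $G$ of order $n$, let $a_k(G)$ be the number of $k$-element vertex subsets of $G$ that induce a connected subgraph (single vertices count as connected), and let $\Phi_G(x)=\sum_{k=1}^n a_k(G)x^k$. The global mean of $G$ is $M_G=\Phi_G'(1)/\Phi_G(1)$, i.e. the average order of the connected induced subgraphs of $G$. $K_{s,t}$ denotes the complete bipartite graph with parts of sizes $s$ and $t$. *)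

(* Defs.v *)
From HB Require Import structures.
From mathcomp Require Import all_boot all_order all_algebra.

Set Implicit Arguments.
Unset Strict Implicit.
Unset Printing Implicit Defensive.

Import Order.TTheory GRing.Theory Num.Theory.
Local Open Scope ring_scope.

Record sgraph := SGraph {
  vertex :> finType;
  adj : rel vertex;
  adj_sym : symmetric adj;
  adj_irrefl : irreflexive adj
}.

Definition isomorphic (G H : sgraph) : Prop :=
  exists2 f : G -> H, bijective f & forall x y : G, adj (f x) (f y) = adj x y.

Section Induced.
Variables (G : sgraph) (S : {set G}).

Definition induced_adj : rel {x : G | x \in S} :=
  fun x y => adj (val x) (val y).

Lemma induced_adj_sym : symmetric induced_adj.
Proof. by move=> x y; apply: adj_sym. Qed.

Lemma induced_adj_irrefl : irreflexive induced_adj.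
Proof. by move=> x; apply: adj_irrefl. Qed.

Definition induced : sgraph := SGraph induced_adj_sym induced_adj_irrefl.

End Induced.

(* The graph without vertices is not connected. *)
Definition connected (G : sgraph) : bool :=
  (0 < #|G|)%N && [forall x : G, forall y : G, connect (@adj G) x y].

Section PathGraph.
Variable n : nat.

Definition path_adj : rel 'I_n :=
  fun i j => (i.+1 == j :> nat) || (j.+1 == i :> nat).

Lemma path_adj_sym : symmetric path_adj.
Proof. by move=> i j; rewrite /path_adj orbC. Qed.

Lemma path_adj_irrefl : irreflexive path_adj.
Proof. by move=> i; rewrite /path_adj orbb gtn_eqF. Qed.

Definition path_graph : sgraph := SGraph path_adj_sym path_adj_irrefl.

End PathGraph.

Section CompleteBipartite.
Variables s t : nat.

Definition bipartite_adj : rel ('I_s + 'I_t)%type :=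
  fun u v => match u, v with
             | inl _, inr _ | inr _, inl _ => true
             | _, _ => false
             end.

Lemma bipartite_adj_sym : symmetric bipartite_adj.
Proof. by case=> ? []. Qed.

Lemma bipartite_adj_irrefl : irreflexive bipartite_adj.
Proof. by case. Qed.

Definition complete_bipartite : sgraph :=
  SGraph bipartite_adj_sym bipartite_adj_irrefl.

End CompleteBipartite.

Definition cograph (G : sgraph) : Prop :=
  ~ exists S : {set G}, isomorphic (induced S) (path_graph 4).

Definition num_connected (G : sgraph) (k : nat) : nat :=
  #|[set S : {set G} | (#|S| == k) && connected (induced S)]|.

Definition Phi (G : sgraph) : {poly rat} :=
  \sum_(1 <= k < #|G|.+1) (num_connected G k)%:R *: 'X^k.

Definition global_mean (G : sgraph) : rat := (Phi G)^`().[1] / (Phi G).[1].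

(* Main.v *)
(* Fix k and give every connected vertex set X the weight k - 2|X|; then
   M_G <= k/2 iff the total weight is nonnegative.  The singletons contribute
   n(k - 2); the function [connected_weight] collects all other sets.

   A cograph with at least two vertices is a disjoint union or a join.  The
   weight is additive over disjoint unions, while a join of parts of sizes s and
   t adds all sets meeting both parts, of total weight
     (k - s - t)ab - sb - ta,   a = 2^s - 1, b = 2^t - 1.
   Since a >= s and b >= t this is nonnegative as soon as k - s - t is close to
   2, so by induction the weight of a proper subset is nonnegative, and it is
   positive if the subset spans an edge.  Writing G itself as a join of parts of
   sizes s + t = n, its weight is thus at least that of K_{s,t}, with equality
   only if both parts are edgeless.  For k = n + 1 this is already positive.  For
   k = n + 1 - c with c = (n-1)^2 / (2^(n-1) + n - 1) it vanishes at K_{1,n-1},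
   and comparing consecutive values of s shows that s = 1 is the minimum. *)

Require Import Defs.
From HB Require Import structures.
From mathcomp Require Import all_boot all_order all_algebra.
From mathcomp Require Import zify ring lra.

Set Implicit Arguments.
Unset Strict Implicit.
Unset Printing Implicit Defensive.

Import Order.TTheory GRing.Theory Num.Theory.
Local Open Scope ring_scope.

(** * Splitting a cograph into a disjoint union or a join *)

(* For [r := adj] this is a separation of [S]; for [r] the non-adjacency
   relation it says that [S] is the join of [A] and [S :\: A]. *)
Definition cut (T : finType) (r : rel T) (S A : {set T}) :=
  [&& A != set0, A \proper S &
   [forall x in A, forall y in S :\: A, ~~ r x y]].

Lemma cutP (T : finType) (r : rel T) (S A : {set T}) :
  reflect [/\ A != set0, A \proper S &
             forall x y, x \in A -> y \in S -> y \notin A -> ~~ r x y]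
          (cut r S A).
Proof.
apply: (iffP and3P) => -[A0 AS Ar]; split=> //.
  by move=> x y xA yS yA; move/forall_inP/(_ x xA)/forall_inP: Ar; apply;
    rewrite inE yA.
apply/forall_inP => x xA; apply/forall_inP => y; rewrite inE => /andP[yA yS].
exact: Ar.
Qed.

Lemma cutC (T : finType) (r : rel T) (S A : {set T}) :
  symmetric r -> cut r S A -> cut r S (S :\: A).
Proof.
move=> rC /cutP[A0 AS Ar]; apply/cutP; split.
- by rewrite setD_eq0; apply: contraTN AS; rewrite properE => ->; rewrite andbF.
- have /set0Pn[x xA] := A0; apply/properP; split; first exact: subsetDl.
  by exists x; [apply: (subsetP (proper_sub AS)) | rewrite inE xA].
- move=> x y; rewrite !inE => /andP[xA xS] yS; rewrite yS andbT negbK => yA.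
  by rewrite rC; apply: Ar.
Qed.

(* The induced path produced when no cut survives is y - x - v - z, where z is
   a neighbour of v across the old cut from y. *)
Lemma cut_setU1 (T : finType) (r : rel T) (S : {set T}) (v : T) :
  symmetric r ->
  (forall a b c d, r a b -> r b c -> r c d ->
     ~~ r a c -> ~~ r a d -> ~~ r b d -> False) ->
  v \notin S -> (exists A, cut r S A) ->
  (exists A, cut r (v |: S) A) \/ exists A, cut (fun x y => ~~ r x y) (v |: S) A.
Proof.
move=> rC P4 vS [A0 cA0].
have [/existsP[y /andP[yS ryv]]|] := boolP [exists y, (y \in S) && ~~ r v y];
  last first.
  (* All of [S] is related to [v], so [v] alone is one side of a cut for the complementary
     relation. *)
  move=> /existsPn nall; right; exists [set v]; apply/cutP; split.
  - by apply/set0Pn; exists v; rewrite inE.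
  - have /cutP[/set0Pn[x xA] /proper_sub/subsetP AS _] := cA0.
    apply/properP; split; first by rewrite sub1set setU11.
    exists x; first by rewrite inE AS ?orbT.
    by rewrite inE; apply: contraNneq vS => <-; apply: AS.
  - move=> x z; rewrite !inE => /eqP-> /orP[->//|zS] _.
    by move/nandP: (nall z); rewrite zS => -[].
have [A cA yA] : exists2 A, cut r S A & y \in A.
  have [yA|yA] := boolP (y \in A0); first by exists A0.
  by exists (S :\: A0); [apply: cutC | rewrite inE yA].
have /cutP[A1 pAS Ar] := cA; have AS := subsetP (proper_sub pAS).
have [/existsP[z /and3P[zS zA rvz]]|] :=
    boolP [exists z, [&& z \in S, z \notin A & r v z]]; last first.
  (* No neighbour of [v] lies outside [A], so [v] can join the side of [A]. *)
  move=> /existsPn nz; left; exists (S :\: A).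
  have /cutP[D0 DS Dr] := cutC rC cA; apply/cutP; split=> //.
    by apply: (proper_sub_trans DS); apply: subsetUr.
  move=> x w xD /setU1P[->|wS] wD; last exact: Dr.
  by move: (nz x); move: xD; rewrite inE => /andP[-> ->]; rewrite rC.
have [/existsP[x /existsP[w /and5P[xA rvx wA rvw rwx]]]|] :=
   boolP [exists x, exists w, [&& x \in A, r v x, w \in A, ~~ r v w & r w x]].
  case: (P4 w x v z) => //; first by rewrite rC.
  - by rewrite rC.
  - exact: Ar.
  - exact: Ar.
(* Inside [A], neighbours and non-neighbours of [v] are now unrelated, so the latter, among them
   [y], split off from everything else. *)
move=> /existsPn nx; left; exists [set x in A | ~~ r v x]; apply/cutP; split.
- by apply/set0Pn; exists y; rewrite inE yA.
- apply/properP; split; last by exists v; rewrite ?setU11 // inE;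
    apply: contra vS => /andP[/AS].
  by apply/subsetP => x; rewrite !inE => /andP[/AS->]; rewrite orbT.
- move=> w x; rewrite inE => /andP[wA rvw] /setU1P[->|xS]; first by rewrite rC.
  rewrite inE negb_and negbK; have [xA /= rvx|xA _] := boolP (x \in A); last exact: Ar.
  by move/existsPn: (nx x) => /(_ w); rewrite xA rvx wA rvw.
Qed.

Lemma cograph_P4_free (G : sgraph) (a b c d : G) : cograph G ->
  adj a b -> adj b c -> adj c d -> ~~ adj a c -> ~~ adj a d -> ~~ adj b d ->
  False.
Proof.
move=> cG ab bc cd /negPf ac /negPf ad /negPf bd; apply: cG.
have ba : adj b a by rewrite adj_sym.
have cb : adj c b by rewrite adj_sym.
have dc : adj d c by rewrite adj_sym.
have ca : adj c a = false by rewrite adj_sym.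
have da : adj d a = false by rewrite adj_sym.
have db : adj d b = false by rewrite adj_sym.
have adjF (x y : G) : adj x y -> x != y by apply: contraTneq => ->; rewrite adj_irrefl.
have ab' := adjF _ _ ab; have bc' := adjF _ _ bc; have cd' := adjF _ _ cd.
(* Identifying two nonadjacent vertices would turn an edge into a nonedge. *)
have ac' : a != c by apply: contraTneq cd => <-; rewrite ad.
have bd' : b != d by apply: contraTneq ab => ->; rewrite ad.
have ad' : a != d by apply: contraTneq cd => <-; rewrite ca.
pose s := [:: a; b; c; d].
have us : uniq s by rewrite /= !inE !negb_or ab' ac' ad' bc' bd' cd'.
pose S := [set x in s]; exists S.
have fP (x : induced S) : (index (val x) s < 4)%N.
  by have := valP x; rewrite inE -index_mem.
pose f (x : induced S) : path_graph 4 := Ordinal (fP x).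
exists f.
  apply: inj_card_bij.
    move=> x y fxy; apply: val_inj.
    have xs : val x \in s by have := valP x; rewrite in_set.
    have ys : val y \in s by have := valP y; rewrite in_set.
    rewrite -(nth_index a xs) -(nth_index a ys); congr nth.
    by have := congr1 val fxy.
  rewrite card_sig card_ord (eq_card (B := mem s)) ?(card_uniqP us) // => x.
  by rewrite in_set.
have nthS i : (i < 4)%N -> nth a s i \in S by move=> i4; rewrite inE mem_nth.
move=> x y; rewrite /= /path_adj /induced_adj /=.
have := valP x; have := valP y; rewrite !inE.
have iE i : (i < 4)%N -> index (nth a s i) s = i by move=> i4; rewrite index_uniq.
have /= i0 := iE 0 isT; have /= i1 := iE 1 isT.
have /= i2 := iE 2 isT; have /= i3 := iE 3 isT.
by case/or4P=> /eqP-> /or4P[]/eqP->; rewrite /= ?i0 ?i1 ?i2 ?i3 ?adj_irrefl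
   ?ab ?ac ?ad ?ba ?bc ?bd ?ca ?cb ?cd ?da ?db ?dc.
Qed.

(** Induction on the size: remove a vertex, cut the rest, and extend the cut by [cut_setU1], applied
    to adjacency or to nonadjacency. *)
Lemma cograph_cut (G : sgraph) (S : {set G}) : cograph G -> (1 < #|S|)%N ->
  (exists A, cut (@adj G) S A) \/ exists A, cut (fun x y => ~~ adj x y) S A.
Proof.
move=> cG; have [m] := ubnP #|S|; elim: m S => // m IHm S leSm gt1S.
have /card_gt0P[v vS] : (0 < #|S|)%N by apply: ltn_trans gt1S.
rewrite -(setD1K vS); have vS' : v \notin S :\ v by rewrite setD11.
move: leSm gt1S; rewrite (cardsD1 v S) vS add1n; set S' := S :\ v in vS' * => leSm gt1S.
have [] := ltnP 1 #|S'|; last first.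
  move=> le1; have /cards1P[w S'E] : #|S'| == 1%N by rewrite eqn_leq le1.
  have wv : w != v by move: vS'; rewrite S'E inE eq_sym.
  have cw (r : rel G) : ~~ r v w -> cut r (v |: S') [set v].
    move=> rvw; rewrite S'E; apply/cutP; split.
    - by apply/set0Pn; exists v; rewrite inE.
    - apply/properP; split; first by rewrite sub1set setU11.
      by exists w; rewrite !inE ?eqxx ?orbT.
    - by move=> x y; rewrite !inE => /eqP-> /orP[->//|/eqP->].
  by have [rvw|rvw] := boolP (adj v w); [right|left]; exists [set v]; apply: cw;
    rewrite ?negbK.
move=> gt1S'; have [//|cA|cA] := IHm S' leSm.
  apply: cut_setU1 => //; first exact: adj_sym.
  by move=> a b c d; apply: cograph_P4_free.
have coC : symmetric (fun x y : G => ~~ adj x y) by move=> x y; rewrite adj_sym.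
have [|cA'|[A /cutP[A0 AS Ar]]] := cut_setU1 coC _ vS' cA.
(* The path on four vertices is self-complementary: a path a-b-c-d of nonedges is the path c-a-d-b
   of edges. *)
- move=> a b c d ab bc cd; rewrite !negbK => ac ad bd.
  by apply: (@cograph_P4_free G c a d b) => //; rewrite ?[adj c a]adj_sym
     ?[adj d b]adj_sym // [adj c b]adj_sym.
- by right.
left; exists A; apply/cutP; split=> // x y xA yS yA.
by move: (Ar x y xA yS yA); rewrite negbK.
Qed.

(** * Connected induced subgraphs *)

Lemma connected_cut (G : sgraph) (A : {set G}) :
  connected G -> ~~ cut (@adj G) [set: G] A.
Proof.
move=> /andP[_ /forallP cG]; apply/negP => /cutP[/set0Pn[x xA] /properP[_ [y _ yA]] Ar].
have cl : closed (@adj G) A.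
  apply: intro_closed => [|u w ruw uA].
    exact/sym_connect_sym/adj_sym.
  by apply: contraTT ruw => wA; apply: Ar.
by have := closed_connect cl (forallP (cG x) y); rewrite xA (negPf yA).
Qed.

Lemma connected_induced_cut (G : sgraph) (S A : {set G}) :
  connected (induced S) -> ~~ cut (@adj G) S A.
Proof.
move=> /connected_cut cS; apply/negP => /cutP[/set0Pn[x xA] /properP[/subsetP AS [y yS yA]] Ar].
move/negP: (cS [set u | val u \in A]); apply; apply/cutP; split.
- by apply/set0Pn; exists (exist _ x (AS _ xA)); rewrite inE.
- by apply/properP; split=> //; exists (exist _ y yS); rewrite !inE.
- by move=> u w; rewrite !inE => uA _ wA; apply: Ar => //; apply: (valP w).
Qed.

(** Two vertices on the same side are linked through any vertex of the other side. *)
Lemma connected_join (G : sgraph) (S A : {set G}) :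
  A \proper S -> A != set0 ->
  (forall x y, x \in A -> y \in S -> y \notin A -> adj x y) ->
  connected (induced S).
Proof.
move=> /properP[/subsetP AS [b bS bA]] /set0Pn[a aA] Ar.
have aS := AS _ aA.
apply/andP; split; first by apply/card_gt0P; exists (exist _ a aS).
have step (x y : induced S) : val x \in A -> val y \notin A -> connect (@adj (induced S)) x y.
  by move=> xA yA; apply: connect1; apply: Ar => //; apply: (valP y).
have pets (x y : induced S) : val x \notin A -> val y \in A -> connect (@adj (induced S)) x y.
  by move=> xA yA; apply: connect1; rewrite adj_sym; apply: Ar => //; apply: (valP x).
apply/forallP => x; apply/forallP => y.
have [xA|xA] := boolP (val x \in A); have [yA|yA] := boolP (val y \in A).
- by apply: (connect_trans (y := exist _ b bS)); [apply: step | apply: pets].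
- exact: step.
- exact: pets.
- by apply: (connect_trans (y := exist _ a aS)); [apply: pets | apply: step].
Qed.

Lemma connected_set1 (G : sgraph) (x : G) : connected (induced [set x]).
Proof.
apply/andP; split; first by apply/card_gt0P; exists (exist _ x (set11 x)).
apply/forallP => u; apply/forallP => w; suff -> : u = w by apply: connect0.
by apply: val_inj; have := valP u; have := valP w; rewrite !inE => /eqP-> /eqP->.
Qed.

Lemma connected_neq0 (G : sgraph) (S : {set G}) : connected (induced S) -> (0 < #|S|)%N.
Proof. by case/andP; rewrite card_sig. Qed.

(** * Weights of disjoint unions and joins *)

Definition connected_weight (G : sgraph) (k : rat) (A : {set G}) : rat :=
  \sum_(X : {set G} | [&& X \subset A, connected (induced X) & (1 < #|X|)%N])
     (k - 2 * #|X|%:R).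

(* The total weight of the sets that meet both of two disjoint sets of sizes [s]
   and [t]. *)
Definition cross_weight (k : rat) (s t : nat) : rat :=
  (k - s%:R - t%:R) * (2 ^+ s - 1) * (2 ^+ t - 1)
  - s%:R * (2 ^+ t - 1) - t%:R * (2 ^+ s - 1).

(** Complementation in [A] pairs [X] with [A :\: X], so 2|X| is |A| on average. *)
Lemma sum_subsets (T : finType) (k : rat) (A : {set T}) :
  \sum_(X : {set T} | X \subset A) (k - 2 * #|X|%:R) = 2 ^+ #|A| * (k - #|A|%:R).
Proof.
have E : \sum_(X : {set T} | X \subset A) (k - 2 * #|X|%:R) =
         \sum_(X : {set T} | X \subset A) (k - 2 * (#|A|%:R - #|X|%:R)).
  rewrite (reindex_onto (setD A) (setD A)) => [|X XA]; last first.
    by rewrite setDDr setDv set0U (setIidPr XA).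
  apply: eq_big => [X|X /andP[_ /eqP XE]].
    by rewrite subsetDl setDDr setDv set0U; apply/eqP/setIidPr.
  have XA : X \subset A by rewrite -XE subsetDl.
  by rewrite cardsDS // natrB // subset_leq_card.
suff D : 2 * \sum_(X : {set T} | X \subset A) (k - 2 * #|X|%:R) =
         2 * (2 ^+ #|A| * (k - #|A|%:R)) by lra.
have -> : 2 * (2 ^+ #|A| * (k - #|A|%:R)) = \sum_(X : {set T} | X \subset A) (2 * (k - #|A|%:R)).
  rewrite sumr_const -(eq_card (A := powerset A)) => [|X]; last by rewrite powersetE.
  by rewrite card_powerset -[RHS]mulr_natl natrX; ring.
rewrite mulrDl mul1r {2}E -big_split /=.
by apply: eq_bigr => X _; ring.
Qed.

(** A connected set meeting both sides would itself be cut by its trace on [A]. *)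
Lemma connected_weight_cut (G : sgraph) (k : rat) (S A : {set G}) :
  cut (@adj G) S A ->
  connected_weight k S = connected_weight k A + connected_weight k (S :\: A).
Proof.
move=> cA; have /cutP[_ /proper_sub AS Ar] := cA.
rewrite /connected_weight (bigID (fun X : {set G} => X \subset A)) /=.
congr (_ + _); apply: eq_bigl => X.
  by apply/andP/and3P => [[/and3P[]]|[XA -> ->]] //; rewrite (subset_trans XA AS) XA.
apply/andP/and3P => [[/and3P[XS cX X1] XA]|[XSA cX X1]]; split=> //.
  rewrite subsetD XS -setI_eq0; apply: contraT => XA0.
  have /negP[] := connected_induced_cut (X :&: A) cX.
  apply/cutP; split=> //; first by rewrite properE subsetIl subsetI subxx.
  move=> x y; rewrite !inE => /andP[xX xA] yX; rewrite yX => /= yA.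
  by apply: Ar => //; apply: (subsetP XS).
- by rewrite (subset_trans XSA (subsetDl _ _)) cX.
- apply/negP => XA; move: XSA; rewrite subsetD => /andP[_ /disjoint_setI0].
  by rewrite (setIidPl XA) => X0; rewrite X0 cards0 in X1.
Qed.

(** A set meeting both sides is itself a join, hence connected, so the cross term does not depend on
    the edges inside the sides. *)
Lemma connected_weight_join (G : sgraph) (k : rat) (S A : {set G}) :
  cut (fun x y => ~~ adj x y) S A ->
  connected_weight k S = connected_weight k A + connected_weight k (S :\: A)
    + cross_weight k #|A| #|S :\: A|.
Proof.
move=> /cutP[A0 /proper_sub AS Ar]; set B := S :\: A.
have BS : B \subset S by apply: subsetDl.
have dAB (X : {set G}) : X \subset A -> (X \subset B) = (X == set0).
  move=> XA; rewrite subsetD (subset_trans XA AS) /= -setI_eq0.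
  by rewrite (setIidPl XA).
(* Inclusion-exclusion over the subsets of [S], [A] and [B]. *)
have crossE : \sum_(X : {set G} | [&& X \subset S, ~~ (X \subset A) & ~~ (X \subset B)])
   (k - 2 * #|X|%:R) = cross_weight k #|A| #|B|.
  have := sum_subsets k S.
  rewrite (bigID (fun X : {set G} => X \subset A)) /=.
  rewrite (eq_bigl (fun X : {set G} => X \subset A)); last first.
    by move=> X; apply/andP/idP => [[]//|XA]; rewrite (subset_trans XA AS).
  rewrite sum_subsets (bigID (fun X : {set G} => X \subset B)) /=.
  (* The empty set is a subset of both sides; it is counted with [A] and taken out of [B]. *)
  have := sum_subsets k B; rewrite (bigD1 set0) ?sub0set //= cards0 => PB.
  rewrite (eq_bigl (fun X : {set G} => (X \subset B) && (X != set0))); last first.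
    move=> X; apply/andP/andP => [[/andP[XS XA] XB]|[XB X0]]; split=> //.
      by apply: contraNneq XA => ->; apply: sub0set.
    rewrite (subset_trans XB BS); apply: contra X0 => XA.
    by rewrite -dAB.
  rewrite (eq_bigl (fun X : {set G} => [&& X \subset S, ~~ (X \subset A) & ~~ (X \subset B)])
    _ (fun X => esym (andbA _ _ _))).
  have -> : #|S| = (#|A| + #|B|)%N by rewrite cardsDS // subnKC // subset_leq_card.
  rewrite natrD exprD /cross_weight.
  move: (\sum_(X | _) _) (\sum_(X | _) _) PB => P Q PB.
  by nra.
rewrite /connected_weight (bigID (fun X : {set G} => X \subset A)) /= -addrA.
congr (_ + _).
  apply: eq_bigl => X.
  by apply/andP/and3P => [[/and3P[]]|[XA -> ->]] //; rewrite (subset_trans XA AS) XA.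
rewrite -crossE (bigID (fun X : {set G} => X \subset B)) /=.
congr (_ + _); apply: eq_bigl => X.
  apply/andP/and3P => [[/andP[/and3P[]]]|[XB cX X1]] //; split=> //.
  rewrite (subset_trans XB BS) cX X1; apply/negP => XA.
  by move: XB X1; rewrite dAB // => /eqP->; rewrite cards0.
apply/andP/and3P => [[/andP[/and3P[]]]|[XS XA XB]] //; split=> //.
have /subsetPn[y yX yA] := XA.
have XA0 : X :&: A != set0.
  by apply: contra XB; rewrite subsetD XS -setI_eq0.
have pA : X :&: A \proper X by rewrite properE subsetIl subsetI subxx.
rewrite XS XA (connected_join pA XA0) /=.
  have := proper_card pA; rewrite andbT; apply: leq_ltn_trans.
  by rewrite card_gt0.
move=> x z; rewrite !inE => /andP[xX xA] zX; rewrite zX => /= zA.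
by rewrite -[adj x z]negbK; apply: Ar => //; apply: (subsetP XS).
Qed.

(** Induction along the decomposition; the hypothesis is bounded by the size of [A] and so passes to
    both parts. *)
Lemma connected_weight_ge0 (G : sgraph) (k : rat) (A : {set G}) : cograph G ->
  (forall s t, (0 < s)%N -> (0 < t)%N -> (s + t <= #|A|)%N -> 0 <= cross_weight k s t) ->
  0 <= connected_weight k A.
Proof.
move=> cG; have [m] := ubnP #|A|; elim: m A => // m IHm A leAm Hk.
have [leA1|ltA1] := leqP #|A| 1.
  rewrite /connected_weight [X in _ <= X]big1 // => X /and3P[XA _].
  by rewrite ltnNge (leq_trans (subset_leq_card XA)).
have main (B : {set G}) : B != set0 -> B \proper A ->
   [/\ 0 <= connected_weight k B, 0 <= connected_weight k (A :\: B) &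
       0 <= cross_weight k #|B| #|A :\: B|].
  move=> B0 pBA; have := proper_card pBA; have BA := proper_sub pBA.
  rewrite -card_gt0 in B0.
  have cAB : (#|B| + #|A :\: B| = #|A|)%N by rewrite cardsDS // subnKC // subset_leq_card.
  move=> ltBA; split.
  - by apply: IHm => [|s t s0 t0 st]; [lia | apply: Hk => //; lia].
  - by apply: IHm => [|s t s0 t0 st]; [lia | apply: Hk => //; lia].
  - by apply: Hk => //; lia.
have [[B cB]|[B cB]] := cograph_cut cG ltA1; have /cutP[B0 pBA _] := cB;
  have [w1 w2 w3] := main B B0 pBA.
  by rewrite (connected_weight_cut _ cB) addr_ge0.
by rewrite (connected_weight_join _ cB) addr_ge0 // addr_ge0.
Qed.

(** A disjoint union keeps the edge inside one part; the first join met on the way down contributes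
    a positive cross weight. *)
Lemma connected_weight_gt0 (G : sgraph) (k : rat) (A : {set G}) (x y : G) : cograph G ->
  (forall s t, (0 < s)%N -> (0 < t)%N -> (s + t <= #|A|)%N -> 0 < cross_weight k s t) ->
  x \in A -> y \in A -> adj x y ->
  0 < connected_weight k A.
Proof.
move=> cG; have [m] := ubnP #|A|; elim: m A => // m IHm A leAm Hk xA yA xy.
have ltA1 : (1 < #|A|)%N.
  apply/card_gt1P; exists x, y; split=> //.
  by apply: contraTneq xy => ->; rewrite adj_irrefl.
have main (B : {set G}) : B != set0 -> B \proper A ->
   [/\ (#|B| < #|A|)%N, (#|A :\: B| < #|A|)%N & 0 < cross_weight k #|B| #|A :\: B|].
  move=> B0 pBA; have := proper_card pBA; have BA := proper_sub pBA.
  rewrite -card_gt0 in B0.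
  have cAB : (#|B| + #|A :\: B| = #|A|)%N by rewrite cardsDS // subnKC // subset_leq_card.
  by move=> ltBA; split=> //; [lia | apply: Hk => //; lia].
have ge0 (B : {set G}) : (#|B| < #|A|)%N -> 0 <= connected_weight k B.
  move=> ltBA; apply: connected_weight_ge0 => // s t s0 t0 st.
  by apply/ltW/Hk => //; lia.
have gt0 (B : {set G}) : (#|B| < #|A|)%N -> x \in B -> y \in B -> 0 < connected_weight k B.
  move=> ltBA xB yB; apply: IHm => // [|s t s0 t0 st]; first by lia.
  by apply: Hk => //; lia.
have [[B cB]|[B cB]] := cograph_cut cG ltA1; have /cutP[B0 pBA Br] := cB;
  have [ltB ltAB cr] := main B B0 pBA; last first.
  by rewrite (connected_weight_join _ cB) ltr_wpDl // addr_ge0 ?ge0.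
rewrite (connected_weight_cut _ cB).
have [xB|xB] := boolP (x \in B); have [yB|yB] := boolP (y \in B).
- by rewrite ltr_pwDl ?gt0 ?ge0.
- by rewrite (negPf (Br x y xB yA yB)) in xy.
- by rewrite adj_sym (negPf (Br y x yB xA xB)) in xy.
- by rewrite ltr_wpDl ?gt0 ?ge0 // inE ?xB ?yB.
Qed.

Lemma connected_weight_edgeless (G : sgraph) (k : rat) (A : {set G}) :
  {in A &, forall x y : G, ~~ adj x y} -> connected_weight k A = 0.
Proof.
move=> A0; rewrite /connected_weight big1 // => X /and3P[/subsetP XA cX X1].
have /card_gt0P[x xX] : (0 < #|X|)%N by apply: ltn_trans X1.
have /negP[] := connected_induced_cut [set x] cX; apply/cutP; split.
- by apply/set0Pn; exists x; rewrite inE.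
- by rewrite properEcard sub1set xX cards1.
- by move=> u w; rewrite !inE => /eqP-> wX _; apply: A0; apply: XA.
Qed.

(** * The global mean in terms of weights *)

Lemma sum_num_connected (G : sgraph) (c : nat -> rat) :
  \sum_(1 <= k < #|G|.+1) (num_connected G k)%:R * c k =
  \sum_(X : {set G} | connected (induced X)) c #|X|.
Proof.
transitivity (\sum_(1 <= k < #|G|.+1)
    \sum_(X : {set G} | (#|X| == k) && connected (induced X)) c #|X|).
  apply: eq_bigr => k _; rewrite (eq_bigr (fun=> c k)) => [|X /andP[/eqP-> _] //].
  by rewrite sumr_const mulr_natl /num_connected cardsE.
rewrite (exchange_big_dep (fun X : {set G} => connected (induced X))) /=; last first.
  by move=> k X _ /andP[].
apply: eq_bigr => X cX.
rewrite (eq_bigl (fun k => k == #|X|)) => [|k]; last by rewrite cX andbT eq_sym.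
by rewrite big_nat1_eq ltnS max_card connected_neq0.
Qed.

Lemma sum_connected_weight (G : sgraph) (k : rat) :
  \sum_(X : {set G} | connected (induced X)) (k - 2 * #|X|%:R) =
  connected_weight k [set: G] + #|G|%:R * (k - 2).
Proof.
rewrite (bigID (fun X : {set G} => 1 < #|X|)%N) /=; congr (_ + _).
  by apply: eq_bigl => X; rewrite subsetT.
rewrite (eq_bigl (mem [set [set x] | x in G])) => [|X].
  rewrite big_imset /= => [|x y _ _]; last exact: set1_inj.
  rewrite (eq_bigr (fun=> k - 2)) => [|x _]; last by rewrite cards1 mulr1.
  by rewrite sumr_const mulr_natl.
apply/andP/imsetP => [[cX X1]|[x _ ->]]; last by rewrite connected_set1 cards1.
have /cards1P[x ->] : #|X| == 1%N by rewrite eqn_leq leqNgt X1 connected_neq0.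
by exists x.
Qed.

(** [N] is the number of connected sets; only its sign matters for comparing the mean with k/2. *)
Lemma global_mean_weight (G : sgraph) (k : rat) : (0 < #|G|)%N ->
  exists2 N : rat, 0 < N &
    (k / 2 - global_mean G) * (2 * N) = connected_weight k [set: G] + #|G|%:R * (k - 2).
Proof.
move=> /card_gt0P[x _].
have EN : (Phi G).[1] = \sum_(X : {set G} | connected (induced X)) 1.
  rewrite -(sum_num_connected G (fun=> 1)) horner_sum; apply: eq_bigr => i _.
  by rewrite hornerZ hornerXn expr1n.
have EW : (Phi G)^`().[1] = \sum_(X : {set G} | connected (induced X)) #|X|%:R.
  rewrite -(sum_num_connected G (fun k => k%:R)) /Phi raddf_sum horner_sum.
  by apply: eq_bigr => i _; rewrite /= derivZ derivXn hornerZ hornerMn hornerXn expr1n.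
have N0 : 0 < (Phi G).[1].
  by rewrite EN (bigD1 [set x]) ?connected_set1 //= ltr_pwDl // sumr_ge0.
exists (Phi G).[1] => //.
rewrite -sum_connected_weight sumrB -mulr_sumr -EW -[k in RHS]mulr1 -mulr_sumr -EN /global_mean.
by field; apply: lt0r_neq0.
Qed.

Lemma global_mean_le (G : sgraph) (k : rat) : (0 < #|G|)%N ->
  (global_mean G <= k / 2) =
  (0 <= connected_weight k [set: G] + #|G|%:R * (k - 2)).
Proof.
move=> /(global_mean_weight k)[N N0 <-].
by rewrite pmulr_lge0 ?mulr_gt0 // subr_ge0.
Qed.

Lemma global_mean_eq (G : sgraph) (k : rat) : (0 < #|G|)%N ->
  global_mean G = k / 2 <->
  connected_weight k [set: G] + #|G|%:R * (k - 2) = 0.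
Proof.
move=> /(global_mean_weight k)[N N0 <-]; split=> [->|/eqP].
  by rewrite subrr mul0r.
by rewrite mulf_eq0 subr_eq0 [_ * _ == 0]gt_eqF ?mulr_gt0 // orbF => /eqP.
Qed.

Lemma connected_cograph_join (G : sgraph) : connected G -> cograph G ->
  (1 < #|G|)%N -> exists A : {set G}, cut (fun x y => ~~ adj x y) [set: G] A.
Proof.
move=> conG cG; rewrite -cardsT => /(cograph_cut cG)[[A cA]|//].
by have := connected_cut A conG; rewrite cA.
Qed.

(** * Estimates for the cross weight *)

Lemma pow2_sub1_ge (s : nat) : s%:R <= 2 ^+ s - 1 :> rat.
Proof. by have := ltn_expl s (ltnSn 1); rewrite -(ler_nat rat) natrX -natr1; lra. Qed.

(** The ratio s / (2^s - 1) decreases and equals 3/7 at s = 3. *)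
Lemma pow2_sub1_ge3 (s : nat) : (2 < s)%N -> 7 * s%:R <= 3 * (2 ^+ s - 1) :> rat.
Proof.
elim: s => // -[//|[//|[|s]]] IHs _; first by lra.
have {IHs} := IHs isT; rewrite [X in _ -> _ <= _ * (X - _)]exprS -[s.+4%:R]natr1.
have s0 : 0 <= s%:R :> rat by [].
by rewrite -!natr1; nra.
Qed.

Lemma cross_weightC (k : rat) (s t : nat) : cross_weight k s t = cross_weight k t s.
Proof. by rewrite /cross_weight; ring. Qed.

(** With a = 2^s - 1 >= s and b = 2^t - 1 >= t, one multiple of ab pays for sb and another for
    ta. *)
Lemma cross_weight_ge0 (k : rat) (s t : nat) : s%:R + t%:R + 2 <= k ->
  0 <= cross_weight k s t.
Proof.
have s0 : 0 <= s%:R :> rat by []; have t0 : 0 <= t%:R :> rat by [].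
rewrite /cross_weight; have := pow2_sub1_ge s; have := pow2_sub1_ge t.
move: (_ ^+ s - 1) (_ ^+ t - 1) => a b tb sa kst.
have ab : 0 <= a * b by rewrite mulr_ge0; lra.
have H1 : 2 * (a * b) <= (k - s%:R - t%:R) * (a * b) by rewrite ler_wpM2r; lra.
have H2 : s%:R * b <= a * b by rewrite ler_wpM2r; lra.
have H3 : t%:R * a <= b * a by rewrite ler_wpM2r; lra.
lra.
Qed.

(* The bound 4/7 makes 2 - c exceed 10/7 = 1 + 3/7, the largest value of
   s/(2^s - 1) + t/(2^t - 1) when s + t >= 4, attained at {s, t} = {1, 3}. *)
Lemma cross_weight_gt0 (n s t : nat) (c : rat) : c < 4 / 7 -> (7 <= n)%N ->
  (0 < s)%N -> (0 < t)%N -> (s + t < n)%N -> 0 < cross_weight (n%:R + 1 - c) s t.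
Proof.
move=> c1 n7 s0 t0 stn.
wlog st : s t s0 t0 stn / (s <= t)%N.
  move=> W; have [|/ltnW] := leqP s t; first exact: W.
  by rewrite cross_weightC; apply: W => //; rewrite addnC.
have sR : 1 <= s%:R :> rat by rewrite ler1n.
have tR : 1 <= t%:R :> rat by rewrite ler1n.
have nR : s%:R + t%:R + 1 <= n%:R :> rat by rewrite -natrD natr1 ler_nat.
have n7R : 7 <= n%:R :> rat by rewrite ler_nat.
have sa := pow2_sub1_ge s; have tb := pow2_sub1_ge t.
have [t3|t2] := ltnP 2 t.
  (* Here sb <= ab and ta <= 3/7 ab, while s + t < n makes the coefficient of ab exceed 10/7. *)
  rewrite /cross_weight; have := pow2_sub1_ge3 t3; move: sa tb.
  move: (_ ^+ s - 1) (_ ^+ t - 1) => a b sa tb tb3.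
  have ab : 0 < a * b by rewrite mulr_gt0; lra.
  have H1 : 10/7 * (a * b) < (n%:R + 1 - c - s%:R - t%:R) * (a * b) by rewrite ltr_pM2r; lra.
  have H2 : s%:R * b <= a * b by rewrite ler_wpM2r; lra.
  have H3 : 7 * t%:R * a <= 3 * b * a by rewrite ler_wpM2r; lra.
  lra.
(* Only s <= t <= 2 remains, where n >= 7 makes the coefficient of ab exceed 3. *)
move: t2 t0 s0 st {sR tR nR sa tb stn}; rewrite /cross_weight.
case: t => [|[|[|]]] // _ _; case: s => [|[|[|]]] // _ _; rewrite ?expr1 ?expr2; lra.
Qed.

(** Moving one vertex between parts of total size n leaves k - s - t = 1 - c unchanged, so only
    simple exponential terms survive. *)
Lemma cross_weight_step (n s u : nat) (c : rat) : n = (s + u).+1 ->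
  cross_weight (n%:R + 1 - c) s.+1 u - cross_weight (n%:R + 1 - c) s u.+1 =
  2 ^+ u * (s%:R - c) - 2 ^+ s * (u%:R - c).
Proof.
by move=> ->; rewrite /cross_weight !exprS -!natr1 natrD; ring.
Qed.

(** The ratio (u - c) / 2^u does not increase from u to u + 1 once u >= c + 1, and u >= 2 ensures
    this. *)
Lemma pow2_step_le (s u : nat) (c : rat) : c <= 1 -> (2 <= s)%N -> (s <= u)%N ->
  2 ^+ s * (u%:R - c) <= 2 ^+ u * (s%:R - c).
Proof.
move=> c1 s2; elim: u => [|u IHu]; first by rewrite leqn0 => /eqP s0; rewrite s0 in s2.
rewrite leq_eqVlt ltnS => /orP[/eqP<-//|su].
have u2 : 2 <= u%:R :> rat by rewrite ler_nat (leq_trans s2).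
rewrite exprS -natr1; apply: (@le_trans _ _ (2 * (2 ^+ s * (u%:R - c)))); last first.
  by rewrite -mulrA ler_wpM2l ?IHu.
rewrite mulrCA ler_wpM2l ?exprn_ge0 //; lra.
Qed.

Lemma pow2_ge_mul6 (u : nat) : (5 <= u)%N -> 6 * u%:R <= 2 ^+ u :> rat.
Proof.
elim: u => // u IHu; rewrite leq_eqVlt => /orP[/eqP[<-]|u5]; first by lra.
have := IHu u5; have : 5 <= u%:R :> rat by rewrite ler_nat.
by rewrite exprS -natr1; lra.
Qed.

(** Starting from sizes 1 and n - 1, vertices move one at a time to the smaller part: the first move
    gains strictly and no later one loses. *)
Lemma cross_weight_min (n s t : nat) (c : rat) : c < 4 / 7 -> (7 <= n)%N ->
  (s + t)%N = n -> (1 < s)%N -> (1 < t)%N ->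
  cross_weight (n%:R + 1 - c) 1 n.-1 < cross_weight (n%:R + 1 - c) s t.
Proof.
move=> c1 n7 stn s1 t1.
wlog st : s t s1 t1 stn / (s <= t)%N.
  move=> W; have [|/ltnW] := leqP s t; first exact: W.
  by rewrite [X in _ < X]cross_weightC; apply: W => //; rewrite addnC.
elim: s s1 t t1 stn st => // s IHs; rewrite ltnS leq_eqVlt => /orP[/eqP<-|s1] t t1 stn st.
  (* The first move gains 2^t (1 - c) - 2 (t - c), positive since 1 - c > 3/7 and 2^t >= 6t. *)
  have nE : n = (1 + t).+1 by rewrite -stn.
  have t5 : (5 <= t)%N by rewrite -stn in n7.
  rewrite -subr_gt0 (_ : n.-1 = t.+1); last by rewrite nE.
  rewrite cross_weight_step // expr1.
  have := pow2_ge_mul6 t5; have : 5 <= t%:R :> rat by rewrite ler_nat.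
  by move: (_ ^+ t) => T; nra.
apply: lt_le_trans (IHs s1 t.+1 _ _ _) _; try lia.
rewrite -subr_ge0 cross_weight_step; last by rewrite -stn.
by rewrite subr_ge0 pow2_step_le; lia || lra.
Qed.

(** For p = n - 1 this gives c < 4/7. At p = 6 it reads 252 < 280; at p = 5 it fails. *)
Lemma pow2_sqr_lt (p : nat) : (6 <= p)%N -> 7 * p%:R ^+ 2 < 4 * (2 ^+ p + p%:R) :> rat.
Proof.
elim: p => // p IHp; rewrite leq_eqVlt => /orP[/eqP[<-]|p6]; first by lra.
have pR : 6 <= p%:R :> rat by rewrite ler_nat.
have H : 6 * p%:R <= p%:R * p%:R :> rat by rewrite ler_wpM2r // (le_trans _ pR).
by have := IHp p6; rewrite [2 ^+ p.+1]exprS -natr1 !expr2; lra.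
Qed.

(** * Recognizing stars *)

Lemma star_isomorphic (n : nat) (G : sgraph) (v : G) : (1 < n)%N -> #|G| = n ->
  (forall x, x != v -> adj v x) ->
  (forall x y, x != v -> y != v -> ~~ adj x y) ->
  isomorphic G (complete_bipartite 1 (n - 1)).
Proof.
move=> n1 Gn vx xy.
have cA : #|[set~ v]| = (n - 1)%N by rewrite cardsC1 Gn subn1.
have /card_gt0P[x0 x0A] : (0 < #|[set~ v]|)%N by rewrite cA subn_gt0.
pose f (x : G) : complete_bipartite 1 (n - 1) :=
  if x == v then inl ord0 else inr (cast_ord cA (enum_rank_in x0A x)).
exists f.
  apply: inj_card_bij; last first.
    by rewrite card_sum !card_ord Gn subnKC // ltnW.
  move=> x y; rewrite /f; have [->|xv] := eqVneq x v; have [->|yv] := eqVneq y v => //.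
  case=> /ord_inj E; apply: (enum_rank_in_inj _ _ E); by rewrite !inE.
move=> x y; rewrite /f; have [->|xv] := eqVneq x v; have [->|yv] := eqVneq y v => //=.
- by rewrite adj_irrefl.
- by rewrite vx.
- by rewrite adj_sym vx.
- by rewrite (negPf (xy x y xv yv)).
Qed.

Lemma isomorphic_star (n : nat) (G : sgraph) :
  isomorphic G (complete_bipartite 1 (n - 1)) ->
  exists v : G, (forall x, x != v -> adj v x) /\
                (forall x y, x != v -> y != v -> ~~ adj x y).
Proof.
case=> f [g fK gK] fA; exists (g (inl ord0)).
have fv x : x != g (inl ord0) -> exists j, f x = inr j.
  move=> xv; case fx: (f x) => [i|j]; last by exists j.
  by case/negP: xv; rewrite -(fK x) fx (ord1 i).
split=> [x /fv[j fx]|x y /fv[j fx] /fv[i fy]]; first by rewrite -fA gK fx.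
by rewrite -fA fx fy.
Qed.

(** * Both bounds with their equality cases *)

Theorem corollary2p7 :
  (forall (n : nat) (G : sgraph),
     (7 <= n)%N -> #|G| = n -> connected G -> cograph G ->
     let bound : rat :=
       (n%:R + 1) / 2 - (n%:R - 1) ^+ 2 / (2 * (2 ^+ (n - 1) + n%:R - 1)) in
     global_mean G <= bound /\
     (global_mean G = bound <-> isomorphic G (complete_bipartite 1 (n - 1)))) /\
  (forall (n : nat) (G : sgraph),
     (1 <= n)%N -> #|G| = n -> connected G -> cograph G ->
     global_mean G <= (n%:R + 1) / 2 /\
     (global_mean G = (n%:R + 1) / 2 <-> n = 1%N)).
Proof.
have cardD (G : sgraph) (A : {set G}) : A != set0 -> A \proper [set: G] ->
    [/\ (0 < #|A|)%N, (0 < #|[set: G] :\: A|)%N & (#|A| + #|[set: G] :\: A|)%N = #|G|].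
  move=> A0 pA; rewrite -card_gt0 in A0; have := proper_card pA.
  rewrite cardsD setTI cardsT => ltA; split=> //; first by rewrite subn_gt0.
  by rewrite subnKC // ltnW.
split=> n G n_ge Gn conG cG; last first.
  have G0 : (0 < #|G|)%N by rewrite Gn.
  suff [ge0 eq0] :
      0 <= connected_weight (n%:R + 1) [set: G] + n%:R * (n%:R + 1 - 2) /\
      (connected_weight (n%:R + 1) [set: G] + n%:R * (n%:R + 1 - 2) = 0 <-> n = 1%N).
    split; first by rewrite global_mean_le // Gn.
    by apply: iff_trans (global_mean_eq _ G0) _; rewrite Gn.
  have [n1|n1] := ltnP 1 n; last first.
    (* A single vertex spans no edge, and k = 2 cancels the singleton term. *)
    have nE : n = 1%N by lia.
    rewrite connected_weight_edgeless ?nE; last first.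
      have /card_le1_eqP eqG : (#|G| <= 1)%N by rewrite Gn.
      by move=> x y _ _; rewrite (eqG x y) // adj_irrefl.
    have -> : 1%:R + 1 - 2 = 0 :> rat by [].
    by rewrite mulr0 addr0; split.
  have [|A cA] := connected_cograph_join conG cG; first by rewrite Gn.
  have /cutP[A0 pA _] := cA; have [s0 t0 stn] := cardD _ _ A0 pA.
  rewrite Gn in stn.
  (* Since [B] is proper, s + t + 1 <= n, that is, k = n + 1 >= s + t + 2. *)
  have ge0 (B : {set G}) : (#|B| < n)%N -> 0 <= connected_weight (n%:R + 1) B.
    move=> ltB; apply: connected_weight_ge0 => // s t _ _ st.
    apply: cross_weight_ge0.
    have : (s + t).+1%:R <= n%:R :> rat by rewrite ler_nat (leq_ltn_trans st).
    by rewrite -natr1 natrD; lra.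
  have gt0 : 0 < connected_weight (n%:R + 1) [set: G] + n%:R * (n%:R + 1 - 2).
    rewrite (connected_weight_join _ cA).
    have wA := ge0 A; have wB := ge0 ([set: G] :\: A).
    move: wA wB s0 t0 stn; set s := #|A|; set t := #|_ :\: A| => wA wB s0 t0 stn.
    have {}wA : 0 <= connected_weight (n%:R + 1) A by apply: wA; lia.
    have {}wB : 0 <= connected_weight (n%:R + 1) ([set: G] :\: A) by apply: wB; lia.
    suff : 0 < cross_weight (n%:R + 1) s t + n%:R * (n%:R + 1 - 2) by lra.
    have sR : 1 <= s%:R :> rat by rewrite ler1n.
    have tR : 1 <= t%:R :> rat by rewrite ler1n.
    have := pow2_sub1_ge s; have := pow2_sub1_ge t.
    rewrite /cross_weight -stn natrD; move: (_ ^+ s - 1) (_ ^+ t - 1) => a b tb sa.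
    (* As k - s - t = 1, the cross weight is (a - s)(b - t) - st, and n(n - 1) with n = s + t
       exceeds st. *)
    have H : 0 <= (a - s%:R) * (b - t%:R) by rewrite mulr_ge0 // subr_ge0.
    by nra.
  split; first exact: ltW.
  by split=> [E|n1E]; [rewrite E ltxx in gt0 | rewrite n1E in n1].
move=> bound.
set p : rat := n%:R - 1; set P : rat := 2 ^+ (n - 1).
pose c := p ^+ 2 / (P + p).
have n7R : 7 <= n%:R :> rat by rewrite ler_nat.
have pE : p = n.-1%:R by rewrite /p; case: (n) n_ge => // m _; rewrite -natr1; ring.
have P0 : 0 < P by rewrite exprn_gt0.
have Pp0 : 0 < P + p by rewrite /p; lra.
have c1 : c < 4 / 7.
  rewrite /c ltr_pdivrMr //.
  have : (6 <= n.-1)%N by lia.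
  by move=> /pow2_sqr_lt; rewrite -pE -subn1 -/P; lra.
have boundE : bound = (n%:R + 1 - c) / 2.
  rewrite /bound /c -/P -/p (_ : P + n%:R - 1 = P + p); last by rewrite /p; ring.
  by field; rewrite gt_eqF.
have G0 : (0 < #|G|)%N by rewrite Gn ltnW // (leq_trans _ n_ge).
(* The left side equals p^2 - c(P + p), which the choice of [c] makes vanish. *)
have star0 : cross_weight (n%:R + 1 - c) 1 n.-1 + n%:R * (n%:R + 1 - c - 2) = 0.
  have cE : c * (P + p) = p ^+ 2 by rewrite /c mulfVK // gt_eqF.
  move: cE; rewrite /cross_weight -pE -subn1 -/P /p expr1 => cE.
  by nra.
suff [ge0 eq0] :
    0 <= connected_weight (n%:R + 1 - c) [set: G] + n%:R * (n%:R + 1 - c - 2) /\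
    (connected_weight (n%:R + 1 - c) [set: G] + n%:R * (n%:R + 1 - c - 2) = 0 <->
     isomorphic G (complete_bipartite 1 (n - 1))).
  rewrite boundE; split; first by rewrite global_mean_le // Gn.
  by apply: iff_trans (global_mean_eq _ G0) _; rewrite Gn.
have gt0 := cross_weight_gt0 c1 n_ge.
have geW (B : {set G}) : (#|B| < n)%N -> 0 <= connected_weight (n%:R + 1 - c) B.
  move=> ltB; apply: connected_weight_ge0 => // s t s0 t0 st.
  by apply/ltW/gt0 => //; apply: leq_ltn_trans ltB.
(* When [v] is adjacent to all other vertices, [star0] cancels the cross weight against the
   singletons. *)
have starE (v : G) : cut (fun x y => ~~ adj x y) [set: G] [set v] ->
    connected_weight (n%:R + 1 - c) [set: G] + n%:R * (n%:R + 1 - c - 2) =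
    connected_weight (n%:R + 1 - c) [set~ v].
  move=> cv; rewrite (connected_weight_join _ cv) connected_weight_edgeless; last first.
    by move=> x y; rewrite !inE => /eqP-> /eqP->; rewrite adj_irrefl.
  rewrite setTD cardsC1 cards1 Gn.
  by move: star0; move: (cross_weight _ _ _) (connected_weight _ _) => *; lra.
have star (v : G) : cut (fun x y => ~~ adj x y) [set: G] [set v] ->
    0 <= connected_weight (n%:R + 1 - c) [set: G] + n%:R * (n%:R + 1 - c - 2) /\
    (connected_weight (n%:R + 1 - c) [set: G] + n%:R * (n%:R + 1 - c - 2) = 0 ->
     isomorphic G (complete_bipartite 1 (n - 1))).
  move=> cv; have ltv : (#|[set~ v]| < n)%N by rewrite cardsC1 Gn; lia.
  rewrite (starE v) //; split=> [|w0]; first exact: geW.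
  apply: (@star_isomorphic n G v) => // [|x xv|x y xv yv]; first by lia.
    have /cutP[_ _ /(_ v x)] := cv; rewrite negbK; apply=> //; by rewrite ?inE.
  (* An edge avoiding [v] would make the remaining weight positive. *)
  apply/negP => xy; suff : 0 < connected_weight (n%:R + 1 - c) [set~ v] by rewrite w0.
  apply: (@connected_weight_gt0 G _ _ x y) => // [s t s0 t0 st||].
  - by apply: gt0 => //; apply: leq_ltn_trans ltv.
  - by rewrite !inE.
  - by rewrite !inE.
have [|A cA] := connected_cograph_join conG cG; first by rewrite Gn; lia.
have /cutP[A0 pA _] := cA; have [s0 t0 stn] := cardD _ _ A0 pA.
rewrite Gn in stn.
have [ge0T eq0] :
    0 <= connected_weight (n%:R + 1 - c) [set: G] + n%:R * (n%:R + 1 - c - 2) /\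
    (connected_weight (n%:R + 1 - c) [set: G] + n%:R * (n%:R + 1 - c - 2) = 0 ->
     isomorphic G (complete_bipartite 1 (n - 1))).
  (* A one-vertex part is a dominating vertex, handled by [star]; otherwise [cross_weight_min] gives
     strict positivity. *)
  have [s1|s1] := leqP #|A| 1.
    have /cards1P[v Av] : #|A| == 1%N by rewrite eqn_leq s1.
    by apply: (star v); rewrite -Av.
  have [t1|t1] := leqP #|[set: G] :\: A| 1.
    have /cards1P[v Av] : #|[set: G] :\: A| == 1%N by rewrite eqn_leq t1.
    by apply: (star v); rewrite -Av; apply: cutC => // x y; rewrite adj_sym.
  suff : 0 < connected_weight (n%:R + 1 - c) [set: G] + n%:R * (n%:R + 1 - c - 2).
    by move=> pos; split; [apply: ltW | move=> E; rewrite E ltxx in pos].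
  rewrite (connected_weight_join _ cA).
  have wA : 0 <= connected_weight (n%:R + 1 - c) A by apply: geW; lia.
  have wB : 0 <= connected_weight (n%:R + 1 - c) ([set: G] :\: A) by apply: geW; lia.
  have := cross_weight_min c1 n_ge stn s1 t1.
  move: star0 wA wB; move: (cross_weight _ 1 _) (cross_weight _ #|_| _).
  by move: (connected_weight _ A) (connected_weight _ (_ :\: _)) => *; lra.
split=> //; split=> [//|/isomorphic_star[v [vx xy]]].
(* Conversely, the leaves of a star are edgeless and weigh zero. *)
rewrite (starE v) ?connected_weight_edgeless //.
  by move=> x y; rewrite !inE; apply: xy.
apply/cutP; split.
- by apply/set0Pn; exists v; rewrite inE.
- by rewrite properEcard subsetT cards1 cardsT Gn; lia.
- by move=> x y; rewrite !inE => /eqP-> _ yv; rewrite negbK vx.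
Qed.
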